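(* Let $f:(0,\infty)\to(0,\infty)$ be a strictly increasing convex function and let $\mathrm{Epi}[f]:=\{(x,y)\in(0,\infty)^2: y\ge f(x)\}$. If $$\liminf_{x\to\infty}\frac{f(x)}{x}>1,$$ then $$\mathrm{Dim}_{\rm H}(\mathrm{Epi}[f])=1+\inf\left\{0<\alpha\le1:\ \int_1^\infty\left(\frac{f^{-1}(x)}{x}\right)^\alpha\frac{dx}{x}<\infty\right\},$$ where $\inf\varnothing:=1$.
   Context: $f^{-1}$ denotes the inverse function of $f$, with $f^{-1}(x):=0$ for those $x>0$ lying below the range of $f$. Macroscopic Hausdorff dimension (Barlow–Taylor) on $\mathbb{R}^2$. For integers $k\ge0$ let $\mathcal{V}_k:=(-e^k,e^k]^2$, $\mathcal{S}_0:=\mathcal{V}_0$, $\mathcal{S}_{k+1}:=\mathcal{V}_{k+1}\setminus\mathcal{V}_k$. For $\rho>0$ and $A\subseteq\mathbb{R}^2$ let $\nu^k_\rho(A):=\inf\sum_{i=1}^m (r_i/e^{k+1})^\rho$, the infimum being over all finite coverings of $A\cap\mathcal{S}_k$ by squares $Q_1,\dots,Q_m\subseteq\mathcal{S}_k$, where $Q_i$ has the form $(x_1,x_1+r_i]\times(x_2,x_2+r_i]$ with $r_i\ge1$. Then $\mathrm{Dim}_{\rm H}(A):=\inf\{\rho>0:\sum_{k=1}^\infty\nu^k_\rho(A)<\infty\}$. *)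

(* Defs.v *)
From HB Require Import structures.
From mathcomp Require Import all_boot all_order all_algebra.
From mathcomp Require Import all_classical all_reals all_analysis.
Import Order.TTheory GRing.Theory Num.Theory.
Import numFieldNormedType.Exports.

Set Implicit Arguments.
Unset Strict Implicit.
Unset Printing Implicit Defensive.

Local Open Scope classical_set_scope.
Local Open Scope ring_scope.

Definition cube (R : realType) (k : nat) : set (R * R) :=
  `] - expR k%:R, expR k%:R] `*` `] - expR k%:R, expR k%:R].

Definition shell (R : realType) (k : nat) : set (R * R) :=
  if k is j.+1 then cube j.+1 `\` cube j else cube 0.

(* A triple (x1, x2, r) encodes the square with lower left corner (x1, x2) and
   side r. *)
Definition square (R : realType) (q : R * R * R) : set (R * R) :=
  `]q.1.1, q.1.1 + q.2] `*` `]q.1.2, q.1.2 + q.2].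

(* The empty list is allowed, and it covers only the empty set. *)
Definition shell_cover (R : realType) (k : nat) (A : set (R * R))
    (s : seq (R * R * R)) : Prop :=
  (forall q, q \in s -> 1 <= q.2 /\ square q `<=` shell k) /\
  A `&` shell k `<=` [set z | exists2 q, q \in s & square q z].

Definition nu (R : realType) (k : nat) (rho : R) (A : set (R * R)) : \bar R :=
  ereal_inf [set (\sum_(q <- s) (q.2 / expR k.+1%:R) `^ rho)%:E
            | s in shell_cover k A].

Definition macro_dim (R : realType) (A : set (R * R)) : \bar R :=
  ereal_inf [set rho%:E | rho in
    [set rho : R | 0 < rho /\ (\sum_(1 <= k <oo) nu k rho A < +oo)%E]].

Definition epi (R : realType) (f : R -> R) : set (R * R) :=
  [set z | [/\ 0 < z.1, 0 < z.2 & f z.1 <= z.2]].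

(* Inverse of the restriction of f to (0, +oo), extended by 0 outside of the
   range; when f is convex and strictly increasing on (0, +oo), the positive
   reals outside of the range are those below it. *)
Definition inv_dflt0 (R : realType) (f : R -> R) (y : R) : R :=
  xget 0 [set x | 0 < x /\ f x = y].

Definition integral_exponents (R : realType) (f : R -> R) : set R :=
  [set alpha | 0 < alpha <= 1 /\
    (\int[lebesgue_measure]_(x in `[1%R, +oo[)
       ((inv_dflt0 f x / x) `^ alpha / x)%:E < +oo)%E].

Definition inf_dflt (R : realType) (d : R) (S : set R) : R :=
  if `[< S = set0 >] then d else inf S.

(* Main.v *)
Require Import Defs.
From HB Require Import structures.
From mathcomp Require Import all_boot all_order all_algebra.
From mathcomp Require Import all_classical all_reals all_analysis.
From mathcomp Require Import measurable_realfun ring lra.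
Import Order.TTheory GRing.Theory Num.Theory.
Import numFieldNormedType.Exports.

Set Implicit Arguments.
Unset Strict Implicit.
Unset Printing Implicit Defensive.

Local Open Scope classical_set_scope.
Local Open Scope ring_scope.

(** Write [g] for the inverse of [f].  Since [f x > x] far out, the part of
    the epigraph lying in the shell [k.+1] is, for large [k], squeezed between
    two thin vertical bands of height [e^k.+1 - e^k], with widths [g (e^k)]
    and [g (e^k.+1)].  The theorem therefore reduces to finding the cheapest
    covering of a band of width [w] and height comparable to [e^k].

    - From above, squares of side comparable to [w] cover the band in two
      columns; about [e^k / w] of them are used, for a total cost of order
      [(w / e^k)^al] at the exponent [1 + al] ([nu_upper]).
    - From below, a square of side [r] meets the band in area at most
      [min r w * r <= w^(1 - al) * r^(1 + al)] when [0 <= al <= 1].  Comparing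
      with the area of the band shows that every covering costs at least a
      constant times [(w / e^k)^al] ([nu_lower]).

    So at the exponent [1 + al], with [0 < al <= 1], the series defining the
    dimension converges if and only if the sum of the [(g (e^k) / e^k)^al]
    does.  As [g] is nondecreasing, cutting [[1, +oo[] at the points [e^k]
    shows that this happens exactly when the integral of [(g x / x)^al / x]
    is finite ([integral_expR_scale]).

    Exponents outside of [(1, 2]] are settled directly: up to [1] the terms
    are eventually bounded below by a positive constant ([nu_sum_le1]), while beyond [2] covering
    with squares of side about [1] makes the series geometric
    ([nu_sum_gt2]).  In particular the dimension is [2] when no [al] is
    admissible.

    Convexity enters through the inverse: it gives [f] the intermediate value
    property, so the range of [f] is a half line and the extension of [g] by
    [0] below that range is nondecreasing ([inv_dflt0_homo]). *)

(** * Powers of e *)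

Lemma expR1_ge2 (R : realType) : 2 <= expR 1 :> R.
Proof. by have := @expR_ge1Dx R 1; rewrite (_ : 1 + 1 = 2)//; lra. Qed.

Lemma expR_natS (R : realType) (k : nat) :
  expR k.+1%:R = expR 1 * expR k%:R :> R.
Proof. by rewrite -expRD -natr1 addrC. Qed.

Lemma expR_nat_ge1 (R : realType) (k : nat) : 1 <= expR k%:R :> R.
Proof. by rewrite -expR0 ler_expR. Qed.

Lemma expR_natS_ge (R : realType) (k : nat) :
  2 * expR k%:R <= expR k.+1%:R :> R.
Proof. by rewrite expR_natS ler_pM2r ?expR_gt0// expR1_ge2. Qed.

Lemma expR_nat_eventually_gt (R : realType) (y : R) :
  exists K : nat, forall k, (K <= k)%N -> y < expR k%:R.
Proof.
exists (Num.truncn (Num.max 0 y)).+1 => k Kk.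
have /andP[_ h] := @truncn_itv R (Num.max 0 y) ltac:(by rewrite le_max lexx).
have : (Num.truncn (Num.max 0 y)).+1%:R <= k%:R :> R by rewrite ler_nat.
have := expR_ge1Dx (k%:R : R); move: h; rewrite gt_max => /andP[_].
lra.
Qed.

(** * Elementary bounds on the covering number of a shell *)

Lemma nu_ge0 (R : realType) (k : nat) (rho : R) (A : set (R * R)) :
  (0 <= nu k rho A)%E.
Proof.
apply/ereal_infP => _ [s _ <-]; rewrite lee_fin.
by apply: sumr_ge0 => q _; exact: powR_ge0.
Qed.

Lemma nu_le (R : realType) (k : nat) (rho : R) (A : set (R * R))
    (s : seq (R * R * R)) : shell_cover k A s ->
  (nu k rho A <= (\sum_(q <- s) (q.2 / expR k.+1%:R) `^ rho)%:E)%E.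
Proof. by move=> sA; apply: ereal_inf_lbound; exists s. Qed.

Lemma nu_ge (R : realType) (k : nat) (rho c : R) (A : set (R * R)) :
  (forall s, shell_cover k A s ->
    c <= \sum_(q <- s) (q.2 / expR k.+1%:R) `^ rho) ->
  (c%:E <= nu k rho A)%E.
Proof. by move=> h; apply/ereal_infP => _ [s /h sc <-]; rewrite lee_fin. Qed.

(** * Coverings by grids of squares *)

(** The half-open intervals are closed on the right, like the sides of the
    squares, so that this locates a point in the cells of a grid. *)
Lemma truncS_itv (R : realType) (z : R) : 0 < z ->
  exists2 n : nat, n%:R < z & z <= n.+1%:R.
Proof.
move=> z0; have /andP[h1 h2] := truncn_itv (ltW z0).
have [e|ne] := eqVneq z (Num.truncn z)%:R.
  case: (Num.truncn z) e h1 h2 => [|m] e h1 h2; first by move: z0; rewrite e ltxx.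
  by exists m; rewrite e // ltr_nat.
by exists (Num.truncn z); [rewrite lt_neqAle eq_sym ne|exact: ltW].
Qed.

Definition grid (R : realType) (x y h : R) (M N : nat) : seq (R * R * R) :=
  [seq (x + i%:R * h, y + j%:R * h, h) | i <- iota 0 M, j <- iota 0 N].

Lemma grid_sub (R : realType) (x y h : R) (M N : nat) : 0 < h ->
  forall q, q \in grid x y h M N -> q.2 = h /\
  square q `<=` `]x, x + M%:R * h] `*` `]y, y + N%:R * h].
Proof.
move=> h0 q /allpairsP[[i j] /=]; rewrite !mem_iota !add0n /= => -[iM jN ->].
split=> // -[u v] [] /=; rewrite !in_itv /= => /andP[u1 u2] /andP[v1 v2].
have H m n : (m < n)%N -> m%:R * h + h <= n%:R * h :> R.
  by move=> mn; rewrite -{2}(mul1r h) -mulrDl natr1 ler_pM2r// ler_nat.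
have iM' := H _ _ iM; have jN' := H _ _ jN.
have ih : 0 <= i%:R * h by rewrite mulr_ge0// ltW.
have jh : 0 <= j%:R * h by rewrite mulr_ge0// ltW.
by split; apply/andP; split; lra.
Qed.

Lemma grid_cover (R : realType) (x y h : R) (M N : nat) : 0 < h ->
  `]x, x + M%:R * h] `*` `]y, y + N%:R * h] `<=`
  [set z | exists2 q, q \in grid x y h M N & square q z].
Proof.
move=> h0 [u v] [] /=; rewrite !in_itv /= => /andP[u1 u2] /andP[v1 v2].
have H z0 z n : z0 < z -> z <= z0 + n%:R * h ->
    exists2 i, (i < n)%N & z0 + i%:R * h < z <= z0 + i%:R * h + h.
  move=> z0z zn.
  have [|i i1 i2] := @truncS_itv _ ((z - z0) / h).
    by rewrite divr_gt0// subr_gt0.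
  move: i1 i2; rewrite ltr_pdivlMr// ler_pdivrMr// -natr1 mulrDl mul1r => i1 i2.
  exists i; last by apply/andP; split; lra.
  have : i%:R * h < n%:R * h by lra.
  by rewrite ltr_pM2r// ltr_nat.
have [i iM iu] := H _ _ _ u1 u2; have [j jN jv] := H _ _ _ v1 v2.
exists (x + i%:R * h, y + j%:R * h, h).
  by apply/allpairsP; exists (i, j); rewrite !mem_iota.
by split; rewrite /= in_itv.
Qed.

Lemma grid_sum (R : realType) (x y h : R) (M N : nat) (F : R -> R) :
  \sum_(q <- grid x y h M N) F q.2 = (M * N)%:R * F h.
Proof.
rewrite (eq_big_seq (fun=> F h)); last first.
  by move=> q /allpairsP[ij [_ _ ->]].
by rewrite big_const_seq count_predT size_allpairs !size_iota iter_addr_0 mulr_natl.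
Qed.

(** The height of the band is cut into [N] equal parts of length [h], the
    largest such length that is at most [t].  Columns are laid from the right edge
    [x = w] leftwards, so that the grid overshoots the band only to the left
    of [x = 0], by less than [h], and stays in [x > - b].  The cost
    [M * N * (h / c)^rho] is split as
    [(M * h / c) * (N * h / c) * (h / c)^(rho - 2)], where [M * h < w + h]
    and [N * h = b - a <= c]. *)
Lemma band_mesh (R : realType) (a b w t : R) : 2 * a <= b -> 1 <= a ->
  0 < w -> w <= b -> 0 < t -> t <= b ->
  exists s h, [/\ t / 2 <= h <= t,
    forall q, q \in s -> q.2 = h /\ square q `<=` `]- b, b] `*` `]a, b],
    `]0, w] `*` `]a, b] `<=` [set z | exists2 q, q \in s & square q z] &
    forall c rho, b <= c ->
      \sum_(q <- s) (q.2 / c) `^ rho <= (w + h) / c * (h / c) `^ (rho - 2)].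
Proof.
move=> ab a1 w0 wb t0 tb.
have Ha : 0 < b - a by lra.
have [|n n1 n2] := @truncS_itv _ ((b - a) / t).
  by rewrite divr_gt0.
pose N := n.+1; pose h := (b - a) / N%:R.
have N0 : 0 < N%:R :> R by rewrite ltr0n.
have h0 : 0 < h by rewrite divr_gt0.
have Nh : N%:R * h = b - a by rewrite /h mulrCA divff ?mulr1// lt0r_neq0.
have ht : h <= t by rewrite ler_pdivrMr// mulrC -ler_pdivrMr.
(* if N = n + 1 with n > 0, then N <= 2 n and n t < b - a; if N = 1, then
   h = b - a >= b / 2 >= t / 2 *)
have th : t / 2 <= h.
  have nt : n%:R * t < b - a by rewrite -ltr_pdivlMr.
  have [n0|n0] := posnP n.
    by move: Nh; rewrite /N n0 mul1r => ->; lra.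
  have N2 : N%:R <= 2 * n%:R :> R.
    by rewrite -natrM ler_nat /N mul2n -addnn -addn1 leq_add2l.
  rewrite ler_pdivlMr//.
  have : t * N%:R <= t * (2 * n%:R) by rewrite ler_pM2l.
  by rewrite mulrA; lra.
have [|m m1 m2] := @truncS_itv _ (w / h); first by rewrite divr_gt0.
move: m1 m2; rewrite ltr_pdivlMr// ler_pdivrMr// => m1 m2.
pose M := m.+1.
have Mh : M%:R * h < w + h by rewrite /M -natr1 mulrDl mul1r; lra.
have hba : h <= b - a.
  by rewrite -Nh -[leLHS]mul1r ler_pM2r// ler1n.
exists (grid (w - M%:R * h) a h M N), h; split.
- by rewrite th ht.
- move=> q /(grid_sub h0)[qh qs]; split=> //; apply: (subset_trans qs).
  rewrite Nh => -[u v] [] /=; rewrite !in_itv /= => /andP[u1 u2] /andP[v1 v2].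
  by split; apply/andP; split; lra.
- apply: subset_trans (grid_cover h0).
  rewrite Nh => -[u v] [] /=; rewrite !in_itv /= => /andP[u1 u2] /andP[v1 v2].
  by split; apply/andP; split; rewrite -/M in m2 *; lra.
- move=> c rho bc.
  have c0 : 0 < c by lra.
  have hc : 0 < h / c by rewrite divr_gt0.
  rewrite (grid_sum _ _ _ _ _ (fun r => (r / c) `^ rho)).
  have -> : (M * N)%:R * (h / c) `^ rho =
     (M%:R * h) / c * ((N%:R * h) / c * (h / c) `^ (rho - 2)).
    have -> : (h / c) `^ rho = (h / c) * (h / c) * (h / c) `^ (rho - 2).
      rewrite -expr2 -powR_mulrn ?ltW// -powRD ?lt0r_neq0 ?implybT//.
      by congr (_ `^ _); ring.
    by rewrite natrM; ring.
  have p0 := powR_ge0 (h / c) (rho - 2).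
  apply: ler_pM.
  + by rewrite divr_ge0 ?mulr_ge0 ?ler0n// ltW.
  + by rewrite mulr_ge0// divr_ge0 ?mulr_ge0 ?ler0n// ltW.
  + by rewrite ler_pM2r ?invr_gt0// ltW.
  + by rewrite ler_piMl// ler_pdivrMr// Nh; lra.
Qed.

(** * Area bound for coverings of a band *)

Lemma lebesgue_oc (R : realType) (a b : R) : a <= b ->
  lebesgue_measure (`]a, b] : set R) = (b - a)%:E.
Proof.
by move=> ab; rewrite lebesgue_measure_itv/= lte_fin; case: ltgtP ab => // ->;
  rewrite subrr.
Qed.

(** Comparison of areas: a square of side [r] meets a strip of width [w] in
    a rectangle of width at most [min r w]. *)
Lemma area_cover_le (R : realType) (w a b : R) (s : seq (R * R * R)) :
  0 <= w -> a <= b -> (forall q, q \in s -> 0 <= q.2) ->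
  `]0, w] `*` `]a, b] `<=` [set z | exists2 q, q \in s & square q z] ->
  w * (b - a) <= \sum_(q <- s) Num.min q.2 w * q.2.
Proof.
move=> w0 ab s0 sub.
pose mu := (@lebesgue_measure R \x @lebesgue_measure R)%E.
pose rect : set (R * R) := `]0, w] `*` `]a, b].
have muE (x u y v : R) : x <= u -> y <= v ->
    mu (`]x, u] `*` `]y, v]) = ((u - x) * (v - y))%:E.
  move=> xu yv; rewrite /mu product_measure1E; [|exact: measurable_itv|exact: measurable_itv].
  by rewrite [X in (X * _)%E](lebesgue_oc xu) [X in (_ * X)%E](lebesgue_oc yv).
have muI q : 0 <= q.2 -> (mu (square q `&` rect) <= (Num.min q.2 w * q.2)%:E)%E.
  move=> q0.
  set x := q.1.1. set y := q.1.2.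
  have H : square q `&` rect `<=`
      (`]Num.max x 0, Num.min (x + q.2) w] `*` `]y, y + q.2]).
    move=> [u v] [[/= + +] [/= + _]]; rewrite !in_itv /= => /andP[u1 u2] /andP[v1 v2] /andP[u3 u4].
    split; last by rewrite v1.
    by rewrite gt_max le_min u1 u2 u3 u4.
  have m1 : measurable (square q `&` rect).
    by apply: measurableI; apply: measurableX.
  have m2 : measurable (`]Num.max x 0, Num.min (x + q.2) w] `*` `]y, y + q.2] : set (R * R)).
    by apply: measurableX.
  apply: (@le_trans _ _ (mu (`]Num.max x 0, Num.min (x + q.2) w] `*` `]y, y + q.2]))).
    by apply: le_measure; rewrite ?inE.
  have [h|h] := leP (Num.max x 0) (Num.min (x + q.2) w).
    rewrite muE ?lerDl// lee_fin addrAC subrr add0r ler_wpM2r//.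
    rewrite le_min; have := ge_min; have := le_max.
    by case: (leP x 0) h; case: (leP (x + q.2) w); rewrite ?andbT; lra.
  rewrite set_itv_ge; last by rewrite -leNgt bnd_simp ltW.
  rewrite set0X (_ : mu set0 = 0%E); last exact: measure0.
  by rewrite lee_fin mulr_ge0// le_min q0 w0.
have : forall r : seq (R * R * R), (forall q, q \in r -> 0 <= q.2) ->
   (mu (rect `&` [set z | exists2 q, q \in r & square q z]) <=
   (\sum_(q <- r) Num.min q.2 w * q.2)%:E)%E.
  elim=> [_|q r IH r0].
    rewrite big_nil.
    have -> : rect `&` [set z | exists2 q, q \in [::] & square q z] = set0.
      by rewrite -subset0 => z [_ [q]]; rewrite in_nil.
    by have -> : mu set0 = 0%E by exact: measure0.
  have mrect : measurable rect by apply: measurableX.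
  have msq p : measurable (square p).
    by apply: measurableX.
  have mr : measurable [set z | exists2 q, q \in r & square q z].
    rewrite (_ : [set z | _] = \big[setU/set0]_(p <- r) square p).
      by apply: bigsetU_measurable => p _; exact: msq.
    by apply/seteqP; split=> z; rewrite -bigcup_seq => -[p pr pz]; exists p.
  have -> : rect `&` [set z | exists2 p, p \in q :: r & square p z] =
      (square q `&` rect) `|` (rect `&` [set z | exists2 p, p \in r & square p z]).
    apply/seteqP; split=> z.
      move=> [zr [p]]; rewrite inE => /orP[/eqP -> pz|pr pz]; first by left.
      by right; split=> //; exists p.
    move=> [[qz zr]|[zr [p pr pz]]]; split=> //.
      by exists q; rewrite ?mem_head.
    by exists p; rewrite // inE pr orbT.
  rewrite big_cons EFinD.
  apply: (@le_trans _ _ (mu (square q `&` rect) +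
     mu (rect `&` [set z | exists2 p, p \in r & square p z]))%E).
    apply: measureU2; apply: measurableI; [exact: msq|exact: mrect|exact: mrect|exact: mr].
  apply: leeD; first by apply/muI/r0/mem_head.
  by apply: IH => p pr; apply: r0; rewrite inE pr orbT.
move=> /(_ s s0); rewrite (setIidl sub) muE// subr0 lee_fin.
exact.
Qed.

(** Interpolation between side and width:
    [min r w = (min r w)^(1 - al) * (min r w)^al <= w^(1 - al) * r^al].
    This is a mass distribution principle for the area measure of the band. *)
Lemma cover_powR_ge (R : realType) (w a b al : R) (s : seq (R * R * R)) :
  0 < w -> a <= b -> 0 <= al <= 1 -> (forall q, q \in s -> 0 < q.2) ->
  `]0, w] `*` `]a, b] `<=` [set z | exists2 q, q \in s & square q z] ->
  w `^ al * (b - a) <= \sum_(q <- s) q.2 `^ (1 + al).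
Proof.
move=> w0 ab /andP[al0 al1] s0 sub.
rewrite -(@ler_pM2l _ (w `^ (1 - al))) ?powR_gt0// mulrA -powRD; last first.
  by rewrite (lt0r_neq0 w0) implybT.
rewrite subrK (powRr1 (ltW w0)).
apply: le_trans (area_cover_le (ltW w0) ab _ sub) _.
  by move=> q /s0/ltW.
rewrite mulr_sumr big_seq [leRHS]big_seq; apply: ler_sum => q /s0 q0.
have m0 : 0 < Num.min q.2 w by rewrite lt_min q0.
have -> : q.2 `^ (1 + al) = q.2 `^ al * q.2.
  by rewrite addrC powRD ?(powRr1 (ltW q0))// (lt0r_neq0 q0) implybT.
rewrite mulrA ler_pM2r//.
have -> : Num.min q.2 w = Num.min q.2 w `^ (1 - al) * Num.min q.2 w `^ al.
  by rewrite -powRD ?subrK ?(powRr1 (ltW m0))// (lt0r_neq0 m0) implybT.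
by apply: ler_pM; rewrite ?powR_ge0//; apply: ge0_ler_powR;
  rewrite ?nnegrE ?subr_ge0 ?(ltW m0) ?(ltW q0) ?(ltW w0)// ge_min lexx ?orbT.
Qed.

(** * Series of nonnegative extended reals *)

Lemma nneseries_shift_lty (R : realType) (u : nat -> \bar R) (n : nat) :
  (forall k, 0 <= u k < +oo)%E ->
  (\sum_(0 <= k <oo) u k < +oo)%E = (\sum_(0 <= k <oo) u (k + n)%N < +oo)%E.
Proof.
move=> u0; have {}u0 k : (0 <= u k)%E /\ (u k < +oo)%E by apply/andP/u0.
rewrite (nneseries_split 0 n) ?add0n => [|k _]; last by case: (u0 k).
rewrite -nneseries_addn => [|k]; last by case: (u0 k).
have sfin : (\sum_(0 <= k < n) u k < +oo)%E.
  by apply: lte_sum_pinfty => k _; case: (u0 k).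
apply/idP/idP => [|h]; last exact: lte_add_pinfty.
apply: le_lt_trans; apply: leeDr.
by apply: sume_ge0 => k _; case: (u0 k).
Qed.

(** Finiteness of the terms lets the domination fail at finitely many
    indices. *)
Lemma nneseries_dom_lty (R : realType) (u v : nat -> \bar R) (C : R) (n : nat) :
  0 <= C -> (forall k, 0 <= u k < +oo)%E -> (forall k, 0 <= v k < +oo)%E ->
  (forall k, (n <= k)%N -> u k <= C%:E * v k)%E ->
  (\sum_(0 <= k <oo) v k < +oo)%E -> (\sum_(0 <= k <oo) u k < +oo)%E.
Proof.
move=> C0 u0 v0 uv; rewrite (nneseries_shift_lty n v0) (nneseries_shift_lty n u0).
move=> vfin; have v0' k : (0 <= v k)%E by case/andP: (v0 k).
apply: (@le_lt_trans _ _ (C%:E * \sum_(0 <= k <oo) v (k + n)%N)%E).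
  rewrite -nneseriesZl//; apply: lee_nneseries => [k _ _|k _].
    by case/andP: (u0 (k + n)%N).
  by apply: uv; exact: leq_addl.
by rewrite lte_mul_pinfty.
Qed.

Lemma nneseries_cst_pinfty (R : realType) (u : nat -> \bar R) (c : R) (n : nat) :
  0 < c -> (forall k, 0 <= u k < +oo)%E ->
  (forall k, (n <= k)%N -> c%:E <= u k)%E ->
  ~ (\sum_(0 <= k <oo) u k < +oo)%E.
Proof.
move=> c0 u0 cu; rewrite (nneseries_shift_lty n u0) => h.
have u0' k : (0 <= u k)%E by case/andP: (u0 k).
have [m sm] : exists m : nat, (\sum_(0 <= k <oo) u (k + n)%N <= (m%:R * c)%:E)%E.
  move: h; have : (0 <= \sum_(0 <= k <oo) u (k + n)%N)%E by apply: nneseries_ge0.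
  case: (\sum_(0 <= k <oo) u (k + n)%N)%E => //= r r0 _; rewrite lee_fin in r0.
  exists (Num.truncn (r / c)).+1; rewrite lee_fin -ler_pdivrMr//.
  by have /andP[_ /ltW] := truncn_itv (divr_ge0 r0 (ltW c0)).
have := le_trans (@nneseries_lim_ge R (fun k => u (k + n)%N) xpredT 0 m.+1
  (fun k _ _ => u0' (k + n)%N)) sm.
apply/negP; rewrite -ltNge.
apply: (@lt_le_trans _ _ (\sum_(0 <= k < m.+1) c%:E)%E).
  by rewrite sumEFin sumr_const_nat subn0 -(mulr_natl c) lte_fin ltr_pM2r// ltr_nat.
by apply: lee_sum => k _; apply: cu; exact: leq_addl.
Qed.

Lemma geometric_lty (R : realType) (q : R) : 0 <= q < 1 ->
  (\sum_(0 <= k <oo) (q ^+ k)%:E < +oo)%E.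
Proof.
move=> /andP[q0 q1]; apply: (@le_lt_trans _ _ (1 - q)^-1%:E); last exact: ltry.
apply: lime_le.
  by apply: is_cvg_nneseries => k _ _; rewrite lee_fin exprn_ge0.
apply: nearW => n; rewrite sumEFin lee_fin big_mkord.
rewrite -[leRHS]mul1r ler_pdivlMr ?subr_gt0// mulrC -opprB mulNr -subrX1 opprB.
by rewrite gerBl exprn_ge0.
Qed.

Lemma nneseries_from1 (R : realType) (u : nat -> \bar R) :
  (forall k, 0 <= u k)%E -> (\sum_(1 <= k <oo) u k = \sum_(0 <= k <oo) u k.+1)%E.
Proof.
move=> u0; rewrite -nneseries_addn//.
by under eq_eseriesr do rewrite addn1.
Qed.

(** * From the integral to a series *)

Definition expR_piece (R : realType) (k : nat) : set R :=
  `[expR k%:R, expR k.+1%:R[.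

Lemma bigcup_expR_piece (R : realType) :
  \bigcup_k @expR_piece R k = `[1, +oo[%classic.
Proof.
apply/seteqP; split=> [x [k _]|x]; rewrite /expR_piece /= !in_itv /= ?andbT.
  by move=> /andP[kx _]; apply: le_trans kx; rewrite -expR0 ler_expR.
move=> x1; have x0 : 0 < x by apply: lt_le_trans x1.
exists (Num.truncn (ln x)) => //=; rewrite ?in_itv /=.
have /andP[h1 h2] : (Num.truncn (ln x))%:R <= ln x < (Num.truncn (ln x)).+1%:R.
  by apply: truncn_itv; rewrite ln_ge0.
by rewrite -{2 3}(lnK x0) ler_expR ltr_expR h1.
Qed.

Lemma trivIset_expR_piece (R : realType) : trivIset setT (@expR_piece R).
Proof.
move=> i j _ _ [x [/=]]; rewrite /expR_piece /= !in_itv /= => /andP[i1 i2] /andP[j1 j2].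
have h1 := le_lt_trans i1 j2; have h2 := le_lt_trans j1 i2.
move: h1 h2; rewrite !ltr_expR !ltr_nat !ltnS => h1 h2.
by apply/eqP; rewrite eqn_leq h1.
Qed.

(** For [x] between [e^k] and [e^k.+1], monotonicity bounds [g x / x] below
    by [g (e^k) / e^k.+1] and above by [g (e^k.+1) / e^k].  The piece has
    length [(e - 1) * e^k], which absorbs the factor [1 / x], so its integral
    is comparable to the term of index [k] on one side and to the term of
    index [k.+1] on the other. *)
Lemma integral_expR_scale (R : realType) (g : R -> R) (al : R) :
  {homo g : x y / x <= y} -> (forall x, 0 <= g x) -> 0 <= al ->
  (\int[lebesgue_measure]_(x in `[1%R, +oo[)
     ((g x / x) `^ al / x)%:E < +oo)%E =
  (\sum_(0 <= k <oo) ((g (expR k%:R) / expR k%:R) `^ al)%:E < +oo)%E.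
Proof.
move=> gm g0 al0.
pose F x := (g x / x) `^ al / x.
pose c k := (g (expR k%:R) / expR k%:R) `^ al.
have e0 : 0 < expR 1 :> R by exact: expR_gt0.
have mE k : measurable (@expR_piece R k) by exact: measurable_itv.
have mV : measurable_fun (`[1%R, +oo[ : set R) (@GRing.inv R).
  apply: subspace_continuous_measurable_fun; first exact: measurable_itv.
  apply: continuous_in_subspaceT => x; rewrite inE /= in_itv /= andbT => x1.
  by apply: inv_continuous; rewrite gt_eqF// (lt_le_trans ltr01).
have mF : measurable_fun (`[1%R, +oo[ : set R) (EFin \o F).
  apply/measurable_EFinP; apply: measurable_funM => //.
  apply: (@measurableT_comp _ _ _ _ _ _ (@powR R ^~ al)) => //; apply: measurable_funM => //.
  by apply: nondecreasing_measurable; first exact: measurable_itv.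
have F0 x : 1 <= x -> 0 <= F x.
  by move=> x1; rewrite /F divr_ge0 ?powR_ge0//; lra.
have ek_gt0 k : 0 < expR k%:R :> R by exact: expR_gt0.
have ek_ge0 k : 0 <= expR k%:R :> R by exact: expR_ge0.
have e_ge0 : 0 <= expR 1 :> R by exact: expR_ge0.
have muE k : lebesgue_measure (@expR_piece R k) = (expR k.+1%:R - expR k%:R)%:E.
  by rewrite /expR_piece lebesgue_measure_itv/= lte_fin ltr_expR ltr_nat leqnn.
have ES k : @expR_piece R k `<=` `[1%R, +oo[.
  by rewrite -bigcup_expR_piece => x kx; exists k.
have mFk k : measurable_fun (@expR_piece R k) (EFin \o F).
  exact: measurable_funS (ES k) mF.
have F0k k x : @expR_piece R k x -> (0 <= (EFin \o F) x)%E.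
  by move/ES; rewrite /= in_itv /= andbT lee_fin; exact: F0.
have low k : (((expR 1)^-1 `^ al * (1 - (expR 1)^-1) * c k)%:E <=
    \int[lebesgue_measure]_(x in @expR_piece R k) (EFin \o F) x)%E.
  rewrite (_ : (_ * c k)%:E = (c k * (expR 1)^-1 `^ al / expR k.+1%:R)%:E *
    lebesgue_measure (@expR_piece R k))%E; last first.
    rewrite muE -EFinM expR_natS; congr EFin; field.
    by rewrite !lt0r_neq0.
  rewrite -integral_cst; last exact: measurable_itv.
  apply: ge0_le_integral; [exact: measurable_itv| | |exact: mFk|] => //.
  - move=> x _; rewrite lee_fin !mulr_ge0 ?powR_ge0// invr_ge0.
  - move=> x kx; have := ES _ _ kx; move: kx; rewrite /expR_piece /= !in_itv /= andbT.
    move=> /andP[kx xk] x1; rewrite lee_fin /F.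
    have x0 : 0 < x by lra.
    have x0' : 0 <= x by lra.
    apply: ler_pM; rewrite ?mulr_ge0 ?powR_ge0 ?invr_ge0//; last first.
      by rewrite lef_pV2 ?posrE// ltW.
    rewrite /c -powRM ?divr_ge0 ?invr_ge0//.
    apply: ge0_ler_powR; rewrite ?nnegrE ?mulr_ge0 ?invr_ge0//.
    rewrite -mulrA -invfM; apply: ler_pM; rewrite ?invr_ge0 ?mulr_ge0//.
      exact: gm.
    rewrite lef_pV2 ?posrE ?mulr_gt0// mulrC (le_trans (ltW xk))//.
    by rewrite expR_natS.
have up k : (\int[lebesgue_measure]_(x in @expR_piece R k) (EFin \o F) x <=
    (expR 1 `^ al * (expR 1 - 1) * c k.+1)%:E)%E.
  rewrite (_ : (_ * c k.+1)%:E = (c k.+1 * expR 1 `^ al / expR k%:R)%:E *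
    lebesgue_measure (@expR_piece R k))%E; last first.
    rewrite muE -EFinM expR_natS; congr EFin; field.
    by rewrite !lt0r_neq0.
  rewrite -integral_cst; last exact: measurable_itv.
  apply: ge0_le_integral; [exact: measurable_itv|exact: F0k|exact: mFk| |] => //.
  - move=> x kx; have := ES _ _ kx; move: kx; rewrite /expR_piece /= !in_itv /= andbT.
    move=> /andP[kx xk] x1; rewrite lee_fin /F.
    have x0 : 0 < x by lra.
    have x0' : 0 <= x by lra.
    apply: ler_pM; rewrite ?mulr_ge0 ?powR_ge0 ?invr_ge0//; last first.
      by rewrite lef_pV2 ?posrE.
    rewrite /c -powRM ?divr_ge0 ?invr_ge0//.
    apply: ge0_ler_powR; rewrite ?nnegrE ?mulr_ge0 ?invr_ge0//.
    rewrite -mulrA; apply: ler_pM; rewrite ?invr_ge0 ?mulr_ge0//.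
      by apply: gm; exact: ltW.
    by rewrite expR_natS invfM mulrAC mulVf ?lt0r_neq0// mul1r lef_pV2 ?posrE.
have C1 : 0 < (expR 1)^-1 `^ al * (1 - (expR 1)^-1) :> R.
  rewrite mulr_gt0 ?powR_gt0 ?invr_gt0// subr_gt0 invf_lt1//.
  by rewrite -[ltLHS]expR0 ltr_expR.
have C2 : 0 <= expR 1 `^ al * (expR 1 - 1) :> R.
  by rewrite mulr_ge0 ?powR_ge0// subr_ge0 -[leLHS]expR0 ler_expR.
have I0 k : (0 <= \int[lebesgue_measure]_(x in @expR_piece R k) (EFin \o F) x < +oo)%E.
  by rewrite integral_ge0 ?(le_lt_trans (up k) (ltry _))//; exact: F0k.
have c0 k : (0 <= (c k)%:E < +oo)%E by rewrite lee_fin powR_ge0 ltry.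
rewrite -bigcup_expR_piece ge0_integral_bigcup//; last exact: trivIset_expR_piece.
- apply/idP/idP.
    apply: (@nneseries_dom_lty _ _ _
      ((expR 1)^-1 `^ al * (1 - (expR 1)^-1))^-1 0) => // [|k _].
      by rewrite invr_ge0 ltW.
    by rewrite lee_pdivlMl; [exact: low|exact: C1].
  rewrite (nneseries_shift_lty (u := fun k => (c k)%:E) 1)//.
  apply: (@nneseries_dom_lty _ (fun k => \int[lebesgue_measure]_(x in
    @expR_piece R k) (EFin \o F) x)%E (fun k => (c (k + 1)%N)%:E) _ 0 C2 I0).
    by move=> k; exact: c0.
  by move=> k _; rewrite addn1; exact: up.
- by rewrite bigcup_expR_piece.
- move=> x; rewrite bigcup_expR_piece /= in_itv /= andbT lee_fin; exact: F0.
Qed.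

(** * Cost of covering a band of a shell *)

Lemma shell_sub_cube (R : realType) (k : nat) : @shell R k `<=` cube k.
Proof. by case: k => [|k]//= z []. Qed.

(** The side is at most the width [2 * e^k] of the cube, and [2 <= e]. *)
Lemma square_shell_side_le (R : realType) (k : nat) (q : R * R * R) :
  0 < q.2 -> square q `<=` shell k -> q.2 <= expR k.+1%:R.
Proof.
move=> q0 /subset_trans/(_ (@shell_sub_cube _ _)) sub.
set b : R := expR k%:R; have b0 : 0 < b by exact: expR_gt0.
have inq u : q.1.1 < u -> u <= q.1.1 + q.2 -> - b < u <= b.
  move=> u1 u2; have [] := sub (u, q.1.2 + q.2).
    by split; rewrite /= in_itv /= ?u1// lexx andbT ltrDl.
  by rewrite /= in_itv.
have /andP[_ h1] := inq (q.1.1 + q.2) ltac:(lra) (lexx _).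
have h2 : - b <= q.1.1.
  rewrite leNgt; apply/negP => h2.
  have /andP[h3 h4] := inq (q.1.1 + q.2) ltac:(lra) (lexx _).
  by have := inq (- b) h2 ltac:(lra); rewrite ltxx.
by have := expR_natS_ge R k; rewrite -/b; lra.
Qed.

Lemma band_sub_shell (R : realType) (k : nat) :
  `]- expR k.+1%:R, expR k.+1%:R] `*` `]expR k%:R, expR k.+1%:R] `<=` @shell R k.+1.
Proof.
move=> [u v] [/=]; rewrite !in_itv /= => u1 /andP[v1 v2]; split.
  split; rewrite /= in_itv//= v2 andbT.
  by apply: lt_trans v1; have := expR_gt0 (k%:R : R); have := expR_gt0 (k.+1%:R : R); lra.
by move=> [_ /=]; rewrite in_itv /=; lra.
Qed.

(** Sides never exceed [e^k.+2], so lowering the exponent [rho] increases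
    the cost; it is enough to treat [rho = 1 + al], where
    [cover_powR_ge] applies.  The constant comes from
    [e^k.+1 - e^k >= e^k.+1 / 2 = e^k.+2 / (2 * e)]. *)
Lemma nu_lower (R : realType) (k : nat) (w al rho : R) (A : set (R * R)) :
  0 < w -> 0 <= al <= 1 -> rho <= 1 + al ->
  `]0, w] `*` `]expR k%:R, expR k.+1%:R] `<=` A `&` shell k.+1 ->
  (((w / expR k.+2%:R) `^ al / (2 * expR 1))%:E <= nu k.+1 rho A)%E.
Proof.
set a : R := expR k%:R; set b : R := expR k.+1%:R; set E : R := expR k.+2%:R.
move=> w0 al01 rl sub; apply: nu_ge => s [s1 s2]; rewrite -/E.
have E0 : 0 < E by exact: expR_gt0.
have ab : 2 * a <= b := expR_natS_ge R k.
have a0 : 0 < a by exact: expR_gt0.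
have sq q : q \in s -> 0 < q.2 / E <= 1.
  move=> /s1[q1 /square_shell_side_le qs].
  rewrite divr_gt0//; last lra.
  by rewrite ler_pdivrMr// mul1r; apply: qs; lra.
apply: (@le_trans _ _ (\sum_(q <- s) (q.2 / E) `^ (1 + al))); last first.
  rewrite big_seq [leRHS]big_seq; apply: ler_sum => q /sq q1.
  exact: ger_powR.
have := @cover_powR_ge R w a b al s w0 _ al01 _ (subset_trans sub s2).
move=> /(_ ltac:(lra)) h.
have {}h : w `^ al * (b - a) <= \sum_(q <- s) q.2 `^ (1 + al).
  by apply: h => q /s1[]; lra.
have -> : \sum_(q <- s) (q.2 / E) `^ (1 + al) =
    (\sum_(q <- s) q.2 `^ (1 + al)) * E^-1 `^ (1 + al).
  rewrite mulr_suml; apply: eq_big_seq => q /s1[q1 _].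
  by rewrite powRM// ?invr_ge0; lra.
apply: (@le_trans _ _ (w `^ al * (b - a) * E^-1 `^ (1 + al))); last first.
  by rewrite ler_wpM2r// powR_ge0.
rewrite powRM ?invr_ge0 ?(ltW w0) ?(ltW E0)// powRD; last first.
  by rewrite invr_eq0 (lt0r_neq0 E0) implybT.
rewrite powRr1 ?invr_ge0 ?(ltW E0)//.
rewrite [leRHS](_ : _ = w `^ al * E^-1 `^ al * ((b - a) / E)); last by ring.
rewrite ler_wpM2l ?mulr_ge0 ?powR_ge0//.
rewrite ler_pdivlMr// /E expR_natS -/b.
rewrite invfM -mulrA mulKf ?lt0r_neq0 ?expR_gt0//; lra.
Qed.

(** With squares of side [h] in [[w / 2, w]], the factor [w + h] in the cost
    given by [band_mesh] is at most [3 * h]. *)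
Lemma nu_upper (R : realType) (k : nat) (w al : R) (A : set (R * R)) :
  2 <= w -> w <= expR k.+1%:R -> 0 <= al ->
  A `&` shell k.+1 `<=` `]0, w] `*` `]expR k%:R, expR k.+1%:R] ->
  (nu k.+1 (1 + al) A <= (3 * (w / expR k.+2%:R) `^ al)%:E)%E.
Proof.
set a : R := expR k%:R; set b : R := expR k.+1%:R; set E : R := expR k.+2%:R.
move=> w2 wb al0 sub; have E0 : 0 < E by exact: expR_gt0.
have w0 : 0 < w by lra.
have [s [h [/andP[h1 h2] sq sc cost]]] :=
  @band_mesh R a b w w (expR_natS_ge R k) (expR_nat_ge1 R k) w0 wb w0 wb.
have cs : shell_cover k.+1 A s.
  split=> [q /sq[qh qs]|]; last exact: subset_trans sc.
  by split; [rewrite qh; lra|exact: subset_trans (@band_sub_shell _ _)].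
apply: le_trans (nu_le _ cs) _; rewrite lee_fin -/E.
have bE : b <= E by have := expR_natS_ge R k.+1; have := expR_gt0 (k.+1%:R : R); rewrite -/b -/E; lra.
apply: le_trans (cost _ _ bE) _.
have hE : 0 < h / E by rewrite divr_gt0//; lra.
apply: (@le_trans _ _ (3 * (h / E) `^ al)); last first.
  by rewrite ler_pM2l//; apply: ge0_ler_powR;
    rewrite ?nnegrE ?(ltW hE)// ?divr_ge0 ?(ltW w0) ?(ltW E0)// ler_pM2r ?invr_gt0.
rewrite (_ : (h / E) `^ al = (h / E) * (h / E) `^ (1 + al - 2)); last first.
  rewrite -{2}(powRr1 (ltW hE)) -powRD ?(lt0r_neq0 hE) ?implybT//.
  by congr (_ `^ _); ring.
by rewrite !mulrA ler_wpM2r ?powR_ge0// ler_pM2r ?invr_gt0//; lra.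
Qed.

(** Inside the first quadrant, a shell is the union of a band and of
    its mirror image in the diagonal.  Covering both with squares of side
    about [1] gives finiteness of every term, and geometric decay as soon as
    [2 < rho]. *)
Lemma nu_quadrant (R : realType) (k : nat) (rho : R) (A : set (R * R)) :
  (forall z, A z -> 0 < z.1 /\ 0 < z.2) -> exists2 h, 1 <= h <= 2 &
  (nu k.+1 rho A <= (2 * (h / expR k.+2%:R) `^ (rho - 2))%:E)%E.
Proof.
set a : R := expR k%:R; set b : R := expR k.+1%:R; set E : R := expR k.+2%:R.
move=> A0; have E0 : 0 < E by exact: expR_gt0.
have ab : 2 * a <= b := expR_natS_ge R k.
have bE : 2 * b <= E := expR_natS_ge R k.+1.
have a1 : 1 <= a := expR_nat_ge1 R k.
have b0 : 0 < b by lra.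
have b2 : 2 <= b by lra.
have [s [h [/andP[h1 h2] sq sc cost]]] :=
  @band_mesh R a b b 2 ab a1 b0 (lexx _) (ltr0n _ _) b2.
exists h; first by lra.
pose flip (q : R * R * R) := (q.1.2, q.1.1, q.2).
have cs : shell_cover k.+1 A (s ++ map flip s).
  split=> [q|[u v] [Az]].
    rewrite mem_cat => /orP[/sq[qh qs]|/mapP[p /sq[ph ps] ->]].
      by split; [rewrite qh; lra|exact: subset_trans (@band_sub_shell _ _)].
    split; first by rewrite /= ph; lra.
    move=> [u v] [/= h3 h4].
    have [|/=] := ps (v, u); first by split.
    rewrite !in_itv /= -/a -/b => v1 /andP[u1 u2]; split.
      split; rewrite /= in_itv//= u2 andbT; rewrite -/b; lra.
    by move=> [/=]; rewrite in_itv /= -/a; lra.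
  have [/= u0 v0] := A0 _ Az.
  move=> [[/=]]; rewrite !in_itv /= -/b => /andP[u1 u2] /andP[v1 v2] nz.
  have [va|va] := leP v a.
    have ua : a < u.
      rewrite ltNge; apply/negP => ua; apply: nz; split; rewrite /= in_itv /= -/a; lra.
    have [|q qs qz] := sc (v, u).
      by split; rewrite /= in_itv /= ?v0 ?ua.
    exists (flip q); first by rewrite mem_cat map_f ?orbT.
    by case: qz.
  have [|q qs qz] := sc (u, v); first by split; rewrite /= in_itv /= ?u0 ?va.
  by exists q; rewrite // mem_cat qs.
apply: le_trans (nu_le _ cs) _; rewrite lee_fin -/E big_cat big_map /=.
have := cost E rho ltac:(lra); set S := \sum_(q <- s) _ => hS.
apply: (@le_trans _ _ (2 * ((b + h) / E * (h / E) `^ (rho - 2)))); first lra.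
rewrite ler_pM2l// ler_piMl ?powR_ge0// ler_pdivrMr//; lra.
Qed.

Lemma nu_quadrant_lty (R : realType) (k : nat) (rho : R) (A : set (R * R)) :
  (forall z, A z -> 0 < z.1 /\ 0 < z.2) -> (nu k.+1 rho A < +oo)%E.
Proof.
by move=> A0; have [h _ /le_lt_trans] := nu_quadrant k rho A0; apply; exact: ltry.
Qed.

(** * The inverse of an increasing convex function *)

Lemma convex_onem (R : realType) (f : R -> R) :
  @convex_function R R^o `]0, +oo[ f ->
  forall x y t : R, 0 < x -> 0 < y -> 0 <= t <= 1 ->
  f (t * x + (1 - t) * y) <= t * f x + (1 - t) * f y.
Proof.
move=> fc x y t x0 y0 t01.
have := fc (Itv01 (proj1 (andP t01)) (proj2 (andP t01))) x y.
rewrite !inE /= !in_itv /= !andbT => /(_ x0 y0).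
by rewrite !convRE.
Qed.

(** Let [x] be the supremum of the points where [f] is at most [y].  If
    [f x < y], the chord from [x] to [b] is still at most [y] a little to the
    right of [x].  If [y < f x], then [x] lies on a chord joining a point just
    to its left, where [f] is at most [y], to a fixed point [c] beyond [b];
    as the left end approaches [x] the height of the chord at [x] tends to a
    value at most [y]. *)
Lemma convex_incr_surj (R : realType) (f : R -> R) (a b y : R) :
  {in `]0, +oo[ &, {homo f : x y / x < y}} ->
  @convex_function R R^o `]0, +oo[ f ->
  0 < a -> 0 < b -> f a <= y -> y < f b -> exists2 x, 0 < x & f x = y.
Proof.
move=> fi /convex_onem fc a0 b0 fay yfb.
have {}fi u v : 0 < u -> u < v -> f u < f v.
  move=> u0 uv; apply: fi => //; rewrite in_itv /= andbT//; exact: lt_trans uv.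
pose S := [set t | 0 < t /\ f t <= y].
have Sb t : S t -> t <= b.
  by move=> [t0 ty]; rewrite leNgt; apply/negP => /(fi _ _ b0); lra.
have hS : has_sup S by split; [exists a|exists b => t /Sb].
pose x := sup S.
have ax : a <= x by apply: ub_le_sup; [case: hS|].
have xb : x <= b by apply: ge_sup; [case: hS|move=> t /Sb].
have Slt t : 0 < t -> t < x -> f t <= y.
  move=> t0 /(sup_gt (proj1 hS))[s [s0 sy] ts].
  by apply: le_trans sy; exact/ltW/fi.
have x0 : 0 < x by lra.
exists x => //; apply/eqP; rewrite eq_le; apply/andP; split; rewrite leNgt; apply/negP => h.
  (* the point c lies strictly to the right of x even when x = b *)
  pose c := b + 1; have c0 : 0 < c by rewrite /c; lra.
  have yfc : y < f c by apply: lt_trans yfb (fi _ _ b0 _); rewrite /c; lra.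
  (* s is the weight of c in x = s c + (1 - s) t; the three bounds make
     1 - s > 0, the chord at x lower than f x, and t > 0 *)
  pose s := Num.min 2^-1 (Num.min ((f x - y) / (2 * (f c - y))) (x / (2 * c))).
  have s0 : 0 < s.
    by rewrite !lt_min invr_gt0 ltr0n !divr_gt0// ?mulr_gt0//; lra.
  have s1 : s <= 2^-1 by rewrite ge_min lexx.
  have s2 : s * (2 * (f c - y)) <= f x - y.
    by rewrite -ler_pdivlMr ?mulr_gt0//; [rewrite !ge_min lexx orbT|lra].
  have s3 : s * (2 * c) <= x.
    by rewrite -ler_pdivlMr ?mulr_gt0// !ge_min lexx !orbT.
  pose t := (x - s * c) / (1 - s).
  have r0 : 0 < 1 - s by lra.
  have t0 : 0 < t by apply: divr_gt0 => //; lra.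
  have tx : t < x.
    have : s * x < s * c by rewrite ltr_pM2l// /c; lra.
    by rewrite ltr_pdivrMr//; lra.
  have := fc c t s c0 t0 _.
  have -> : s * c + (1 - s) * t = x by rewrite /t; field; rewrite lt0r_neq0.
  move=> /(_ ltac:(lra)).
  have : (1 - s) * f t <= (1 - s) * y by rewrite ler_pM2l//; exact: Slt.
  lra.
(* s is the weight of x at the point where the chord from x to b has height y *)
pose s := (f b - y) / (f b - f x).
have d0 : 0 < f b - f x by lra.
have s1 : 0 <= s < 1.
  by apply/andP; split; [apply: divr_ge0; lra|rewrite ltr_pdivrMr//; lra].
have xltb : x < b.
  rewrite lt_neqAle xb andbT; apply/negP => /eqP xb'; move: h; rewrite xb'; lra.
have := fc x b s x0 b0 _.
have -> : s * f x + (1 - s) * f b = y.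
  by rewrite /s; field; rewrite lt0r_neq0.
move=> /(_ ltac:(lra)) h1.
have pos : 0 < (1 - s) * (b - x) by rewrite mulr_gt0//; lra.
have : s * x + (1 - s) * b <= x.
  apply: ub_le_sup; first by case: hS.
  by split=> //; nra.
by nra.
Qed.

Lemma liminf_slope_gt1 (R : realType) (f : R -> R) :
  (1 < limf_einf (fun x => (f x / x)%:E) (pinfty_nbhs R))%E ->
  exists2 X, 0 < X & forall x, X < x -> x < f x.
Proof.
rewrite limf_einfE => /ereal_sup_gt[_ [V [M [_ MV]] <-]] h.
exists (Num.max 1 M); first by rewrite lt_max ltr01.
move=> x; rewrite gt_max => /andP[x1 Mx].
have x0 : 0 < x by lra.
have : (1 < (f x / x)%:E)%E.
  by apply: (lt_le_trans h); apply: ereal_inf_lbound; exists x => //; exact: MV.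
by rewrite lte_fin ltr_pdivlMr// mul1r.
Qed.

Lemma incr_le (R : realType) (f : R -> R) (x y : R) :
  {in `]0, +oo[ &, {homo f : x y / x < y}} ->
  0 < x -> 0 < y -> (f x <= f y) = (x <= y).
Proof.
move=> f_incr x0 y0; apply/idP/idP; last first.
  rewrite le_eqVlt => /predU1P[->//|xy]; apply/ltW/f_incr => //;
  by rewrite in_itv /= andbT.
apply: contraTT; rewrite -!ltNge => yx.
by apply: f_incr => //; rewrite in_itv /= andbT.
Qed.

Lemma inv_dflt0_ge0 (R : realType) (f : R -> R) (y : R) : 0 <= inv_dflt0 f y.
Proof. by rewrite /inv_dflt0; case: xgetP => [x _ [/ltW]|]. Qed.

Lemma inv_dflt0K (R : realType) (f : R -> R) (y : R) :
  0 < inv_dflt0 f y -> f (inv_dflt0 f y) = y.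
Proof.
by rewrite /inv_dflt0; case: xgetP => [x _ []|_]//; rewrite ltxx.
Qed.

(** The value [y] is attained because it lies above the value [f x]; the
    extension by [0] is used only below the range of [f]. *)
Lemma inv_dflt0_ge (R : realType) (f : R -> R) (x y : R) :
  {in `]0, +oo[ &, {homo f : x y / x < y}} ->
  @convex_function R R^o `]0, +oo[ f ->
  (forall y, exists2 b, 0 < b & y < f b) ->
  0 < x -> f x <= y -> x <= inv_dflt0 f y.
Proof.
move=> f_incr f_convex f_unbounded x0 xy; have [b b0 yb] := f_unbounded y.
have [z z0 zy] := convex_incr_surj f_incr f_convex x0 b0 xy yb.
have [] := @xgetPex R 0 [set x | 0 < x /\ f x = y] (ex_intro _ z (conj z0 zy)).
rewrite -/(inv_dflt0 f y) => g0 gy.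
by rewrite -(incr_le f_incr)// gy.
Qed.

Lemma inv_dflt0_homo (R : realType) (f : R -> R) :
  {in `]0, +oo[ &, {homo f : x y / x < y}} ->
  @convex_function R R^o `]0, +oo[ f ->
  (forall y, exists2 b, 0 < b & y < f b) ->
  {homo inv_dflt0 f : x y / x <= y}.
Proof.
move=> f_incr f_convex f_unbounded x y xy.
have := inv_dflt0_ge0 f x; rewrite le_eqVlt => /predU1P[<-|gx].
  exact: inv_dflt0_ge0.
by apply: (inv_dflt0_ge f_incr f_convex f_unbounded); rewrite // inv_dflt0K.
Qed.

Lemma liminf_unbounded (R : realType) (f : R -> R) :
  (1 < limf_einf (fun x => (f x / x)%:E) (pinfty_nbhs R))%E ->
  forall y, exists2 b, 0 < b & y < f b.
Proof.
move=> f_liminf y.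
have [X X0 Xf] := liminf_slope_gt1 f_liminf.
exists (Num.max X y + 1); first by rewrite ltr_pwDr// le_max ltW.
apply: (@lt_trans _ _ (Num.max X y + 1)).
  by rewrite ltr_pwDr// le_max lexx orbT.
by apply: Xf; rewrite ltr_pwDr// le_max lexx.
Qed.

(** * The epigraph in the shells *)

Lemma epi_quadrant (R : realType) (f : R -> R) (z : R * R) :
  epi f z -> 0 < z.1 /\ 0 < z.2.
Proof. by case. Qed.

(** The lower edge of the epigraph is above the diagonal far out, so a point
    of the epigraph with [y <= e^k] also has [x <= e^k] and lies in the
    smaller cube.  Above that level, membership in the epigraph amounts to
    [x <= inv_dflt0 f y], which is monotone in [y]. *)
Lemma epi_shell_band (R : realType) (f : R -> R) :
  {in `]0, +oo[ &, {homo f : x y / x < y}} ->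
  @convex_function R R^o `]0, +oo[ f ->
  (1 < limf_einf (fun x => (f x / x)%:E) (pinfty_nbhs R))%E ->
  exists K : nat, forall k, (K <= k)%N ->
  [/\ 2 <= inv_dflt0 f (expR k%:R), inv_dflt0 f (expR k%:R) <= expR k%:R,
    epi f `&` shell k.+1 `<=`
      `]0, inv_dflt0 f (expR k.+1%:R)] `*` `]expR k%:R, expR k.+1%:R] &
    `]0, inv_dflt0 f (expR k%:R)] `*` `]expR k%:R, expR k.+1%:R] `<=`
      epi f `&` shell k.+1].
Proof.
move=> f_incr f_convex f_liminf.
have [X X0 Xf] := liminf_slope_gt1 f_liminf.
have X2 : 0 < X + 2 by lra.
have [K hK] := expR_nat_eventually_gt (Num.max X (f (X + 2))).
exists K => k /hK; rewrite gt_max.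
set a : R := expR k%:R; set b : R := expR k.+1%:R => /andP[Xa fa].
have ab : 2 * a <= b := expR_natS_ge R k.
have a0 : 0 < a by exact: expR_gt0.
(* a width above X + 2 lies where f exceeds the identity, and squares of half
   that width still have side at least 1 *)
have ga : X + 2 <= inv_dflt0 f a.
  by apply: (inv_dflt0_ge f_incr f_convex (liminf_unbounded f_liminf)) => //; exact: ltW.
have ga0 : 0 < inv_dflt0 f a by lra.
have gaa : inv_dflt0 f a <= a by rewrite -{2}(inv_dflt0K ga0); apply/ltW/Xf; lra.
split=> //; first by lra.
  move=> [x y] [[/= x0 y0 fxy]] [[/=]]; rewrite !in_itv /= -/b => /andP[x1 x2] /andP[y1 y2] nz.
  split; rewrite /= ?in_itv /=.
    rewrite x0/=; apply: (inv_dflt0_ge f_incr f_convex (liminf_unbounded f_liminf)) => //.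
    exact: le_trans y2.
  rewrite y2 andbT -/a ltNge; apply/negP => ya; apply: nz.
  split; rewrite /= in_itv /= -/a; apply/andP; split; try lra.
  rewrite leNgt; apply/negP => ax.
  have := Xf x ltac:(lra); lra.
move=> [x y] [/=]; rewrite !in_itv /= => /andP[x0 xg] /andP[ay yb].
split.
  split=> /=; [by []|lra|].
  apply: (@le_trans _ _ (f (inv_dflt0 f a))); first by rewrite (incr_le f_incr).
  by rewrite inv_dflt0K// ltW.
apply: band_sub_shell; split; rewrite /= in_itv /= -/a -/b; lra.
Qed.

(** * Convergence of the dimension series *)

Lemma nu_epi_fin (R : realType) (f : R -> R) (rho : R) (k : nat) :
  (0 <= nu k.+1 rho (epi f) < +oo)%E.
Proof. by rewrite nu_ge0 nu_quadrant_lty//; exact: epi_quadrant. Qed.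

Lemma scale_fin (R : realType) (g : R -> R) (al : R) (k : nat) :
  (0 <= ((g (expR k%:R) / expR k%:R) `^ al)%:E < +oo)%E.
Proof. by rewrite lee_fin powR_ge0 ltry. Qed.

Lemma integral_inv_dflt0 (R : realType) (f : R -> R) (al : R) :
  {in `]0, +oo[ &, {homo f : x y / x < y}} ->
  @convex_function R R^o `]0, +oo[ f ->
  (1 < limf_einf (fun x => (f x / x)%:E) (pinfty_nbhs R))%E ->
  0 <= al ->
  (\int[lebesgue_measure]_(x in `[1%R, +oo[)
     ((inv_dflt0 f x / x) `^ al / x)%:E < +oo)%E =
  (\sum_(0 <= k <oo) ((inv_dflt0 f (expR k%:R) / expR k%:R) `^ al)%:E < +oo)%E.
Proof.
move=> f_incr f_convex f_liminf al0; apply: integral_expR_scale => //; last exact: inv_dflt0_ge0.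
exact: (inv_dflt0_homo f_incr f_convex (liminf_unbounded f_liminf)).
Qed.

Lemma nu_sum_upper (R : realType) (f : R -> R) (al : R) :
  {in `]0, +oo[ &, {homo f : x y / x < y}} ->
  @convex_function R R^o `]0, +oo[ f ->
  (1 < limf_einf (fun x => (f x / x)%:E) (pinfty_nbhs R))%E ->
  0 < al ->
  (\int[lebesgue_measure]_(x in `[1%R, +oo[)
     ((inv_dflt0 f x / x) `^ al / x)%:E < +oo)%E ->
  (\sum_(1 <= k <oo) nu k (1 + al) (epi f) < +oo)%E.
Proof.
move=> f_incr f_convex f_liminf al0.
rewrite integral_inv_dflt0 ?(ltW al0)// => h.
rewrite nneseries_from1 => [|k]; last exact: nu_ge0.
have [K hK] := epi_shell_band f_incr f_convex f_liminf.
apply: (@nneseries_dom_lty _ (fun k => nu k.+1 (1 + al) (epi f))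
   (fun k => ((inv_dflt0 f (expR (k + 1)%:R) / expR (k + 1)%:R) `^ al)%:E) 3 K).
- by [].
- exact: nu_epi_fin.
- by move=> k; exact: scale_fin.
- move=> k Kk; have [_ _ sub _] := hK _ Kk.
  have [g2 gb _ _] := hK _ (leqW Kk); rewrite addn1.
  apply: le_trans (nu_upper g2 gb (ltW al0) sub) _.
  rewrite -EFinM lee_fin; apply: ler_wpM2l; first exact: ler0n.
  have g0 : 0 <= inv_dflt0 f (expR k.+1%:R) by exact: inv_dflt0_ge0.
  apply: ge0_ler_powR; rewrite ?nnegrE ?(ltW al0) ?divr_ge0 ?expR_ge0//.
  apply: ler_wpM2l => //; rewrite lef_pV2 ?posrE ?expR_gt0// ler_expR ler_nat//.
- exact: (etrans (esym (nneseries_shift_lty 1 (scale_fin (inv_dflt0 f) al))) h).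
Qed.

Lemma nu_sum_gt2 (R : realType) (f : R -> R) (rho : R) : 2 < rho ->
  (\sum_(1 <= k <oo) nu k rho (epi f) < +oo)%E.
Proof.
move=> rho2; rewrite nneseries_from1 => [|k]; last exact: nu_ge0.
pose q : R := expR (-1) `^ (rho - 2).
have q01 : 0 <= q < 1.
  by rewrite powR_ge0 /q -expRM -[ltRHS]expR0 ltr_expR; lra.
apply: (@nneseries_dom_lty _ (fun k => nu k.+1 rho (epi f))
   (fun k => (q ^+ k)%:E) (2 * 2 `^ (rho - 2)) 0).
- by rewrite mulr_ge0// powR_ge0.
- exact: nu_epi_fin.
- by move=> k; rewrite lee_fin exprn_ge0 ?ltry//; case/andP: q01.
- move=> k _; have [h /andP[h1 h2] hn] := nu_quadrant k rho (@epi_quadrant R f).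
  apply: (le_trans hn); rewrite -EFinM lee_fin -mulrA ler_pM2l//.
  have -> : q ^+ k = expR (- k%:R) `^ (rho - 2).
    by rewrite /q -!expRM -expRM_natl; congr expR; ring.
  rewrite -powRM ?expR_ge0//; apply: ge0_ler_powR.
  + lra.
  + by rewrite nnegrE divr_ge0 ?expR_ge0//; lra.
  + by rewrite nnegrE mulr_ge0 ?expR_ge0.
  apply: ler_pM; rewrite ?invr_ge0 ?expR_ge0//; first lra.
  by rewrite -expRN ler_expR lerN2 ler_nat; exact: leqW.
- exact: geometric_lty.
Qed.

Lemma nu_sum_le1 (R : realType) (f : R -> R) (rho : R) :
  {in `]0, +oo[ &, {homo f : x y / x < y}} ->
  @convex_function R R^o `]0, +oo[ f ->
  (1 < limf_einf (fun x => (f x / x)%:E) (pinfty_nbhs R))%E ->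
  rho <= 1 ->
  ~ (\sum_(1 <= k <oo) nu k rho (epi f) < +oo)%E.
Proof.
move=> f_incr f_convex f_liminf rho1; rewrite nneseries_from1 => [|k]; last exact: nu_ge0.
have [K hK] := epi_shell_band f_incr f_convex f_liminf.
apply: (@nneseries_cst_pinfty _ (fun k => nu k.+1 rho (epi f)) (2 * expR 1)^-1 K).
- by rewrite invr_gt0 mulr_gt0 ?expR_gt0.
- exact: nu_epi_fin.
move=> k /hK[g2 _ _ sub].
have g0 : 0 < inv_dflt0 f (expR k%:R) by lra.
have := @nu_lower R k _ 0 rho _ g0 _ _ sub.
rewrite powRr0 div1r addr0 lexx ler01; exact.
Qed.

(** The cost of the shell [k.+1] is measured against [e^k.+2], whereas the
    term of index [k] of the series involves [e^k]; the constant [(e * e)^al]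
    makes up for this. *)
Lemma nu_sum_lower (R : realType) (f : R -> R) (al : R) :
  {in `]0, +oo[ &, {homo f : x y / x < y}} ->
  @convex_function R R^o `]0, +oo[ f ->
  (1 < limf_einf (fun x => (f x / x)%:E) (pinfty_nbhs R))%E ->
  0 < al <= 1 ->
  (\sum_(1 <= k <oo) nu k (1 + al) (epi f) < +oo)%E ->
  (\int[lebesgue_measure]_(x in `[1%R, +oo[)
     ((inv_dflt0 f x / x) `^ al / x)%:E < +oo)%E.
Proof.
move=> f_incr f_convex f_liminf /andP[al0 al1].
rewrite integral_inv_dflt0 ?(ltW al0)//.
rewrite nneseries_from1 => [|k]; last exact: nu_ge0.
have [K hK] := epi_shell_band f_incr f_convex f_liminf.
pose C : R := (expR 1 * expR 1) `^ al * (2 * expR 1).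
have e0 : 0 < expR 1 :> R by exact: expR_gt0.
apply: (@nneseries_dom_lty _ _ (fun k => nu k.+1 (1 + al) (epi f)) C K).
- by rewrite mulr_ge0 ?powR_ge0// mulr_ge0 ?expR_ge0.
- exact: scale_fin.
- exact: nu_epi_fin.
move=> k /hK[g2 _ _ sub].
have g0 : 0 < inv_dflt0 f (expR k%:R) by lra.
have h := @nu_lower R k _ al (1 + al) _ g0 ltac:(lra) (lexx _) sub.
apply: (@le_trans _ _ (C%:E * ((inv_dflt0 f (expR k%:R) / expR k.+2%:R) `^ al / (2 * expR 1))%:E)%E); last first.
  by apply: lee_wpmul2l => //; rewrite lee_fin mulr_ge0 ?powR_ge0// mulr_ge0 ?expR_ge0.
rewrite -EFinM lee_fin /C mulrACA divff ?mulr1; last by rewrite lt0r_neq0// mulr_gt0.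
rewrite -powRM ?mulr_ge0 ?divr_ge0 ?expR_ge0 ?(ltW g0)//.
rewrite !expR_natS le_eqVlt; apply/orP; left; apply/eqP; congr (_ `^ _).
by field; rewrite !lt0r_neq0 ?expR_gt0.
Qed.

(** * The dimension *)

Theorem proposition1p3 (R : realType) (f : R -> R)
  (f_pos : forall x : R, 0 < x -> 0 < f x)
  (f_incr : {in `]0, +oo[ &, {homo f : x y / x < y}})
  (f_convex : @convex_function R R^o `]0, +oo[ f)
  (f_liminf : (1 < limf_einf (fun x => (f x / x)%:E) (pinfty_nbhs R))%E) :
  macro_dim (epi f) = (1 + (inf_dflt 1 (integral_exponents f))%:E)%E.
Proof.
pose T := [set rho : R | 0 < rho /\ (\sum_(1 <= k <oo) nu k rho (epi f) < +oo)%E].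
have T_of al : integral_exponents f al -> T (1 + al).
  move=> [/andP[al0 al1] h]; split; first lra.
  exact: (nu_sum_upper f_incr f_convex f_liminf).
have T_gt2 rho : 2 < rho -> T rho.
  by move=> h; split; [lra|exact: nu_sum_gt2].
have of_T rho : T rho -> rho <= 2 -> integral_exponents f (rho - 1).
  move=> [_ h] h2.
  have h1 : 1 < rho.
    by rewrite ltNge; apply/negP => /(nu_sum_le1 f_incr f_convex f_liminf); exact.
  split; first lra.
  apply: (nu_sum_lower f_incr f_convex f_liminf); first lra.
  by rewrite addrC subrK.
(* T contains ]2, +oo[, and its part below 2 is the translate by 1 of
   integral_exponents f; this is why the empty infimum has to count as 1 *)
rewrite -EFinD /macro_dim -/T /inf_dflt; case: asboolP => [IE0|/eqP/set0P[al0 IEal0]].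
  apply/eqP; rewrite eq_le; apply/andP; split; last first.
    apply/ereal_infP => _ [rho Trho <-]; rewrite lee_fin leNgt; apply/negP => h.
    by have := of_T _ Trho ltac:(lra); rewrite IE0.
  apply/lee_addgt0Pr => e e0; apply: ereal_inf_lbound.
  by exists (1 + 1 + e) => //; apply: T_gt2; lra.
have hI : has_inf (integral_exponents f).
  by split; [exists al0|exists 0 => al [/andP[/ltW]]].
apply/eqP; rewrite eq_le; apply/andP; split; last first.
  apply/ereal_infP => _ [rho Trho <-]; rewrite lee_fin.
  have [h|h] := leP rho 2.
    have := ge_inf (proj2 hI) (of_T _ Trho h); lra.
  have := ge_inf (proj2 hI) IEal0.
  have [/andP[_ ?] _] := IEal0; lra.
apply/lee_addgt0Pr => e e0.
have [al IEal ale] := inf_adherent e0 hI.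
apply: (@le_trans _ _ (1 + al)%:E).
  by apply: ereal_inf_lbound; exists (1 + al) => //; exact: T_of.
by rewrite -EFinD lee_fin; lra.
Qed.
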